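(* Let $(\mathcal{R},\oplus,+)$ be a perfect commutative cancellative semi-ring of characteristic $1$ with fixed element $E$, satisfying the standing assumptions in the context. Then the map $$j:(\mathcal{R},\oplus,+)\to(C^0(S_E(\mathcal{R}),\mathbb{R}),\max(\,,),+),\qquad X\mapsto j_X,\quad j_X(\phi)=\phi(X),$$ is an injective homomorphism of semi-rings.
   Context: A commutative semi-ring of characteristic $1$ is a triple $(\mathcal{R},\oplus,+)$ with two associative laws such that: $(\mathcal{R},+)$ is an abelian monoid with identity $0$; $\oplus$ is commutative with $X\oplus X=X$ for all $X$; and $X+(Y\oplus Z)=(X+Y)\oplus(X+Z)$ for all $X,Y,Z$. It is cancellative if $X+Y=X+Z$ implies $Y=Z$, and perfect if for every integer $n\ge1$ the map $X\mapsto nX$ is surjective (in the cancellative case it is then bijective, which defines an action $(t,X)\mapsto tX$ of the positive rationals). Partial order: $X\le Y$ iff $X\oplus Y=Y$. A cancellative $\mathcal{R}$ embeds canonically in its semi-field of fractions $\mathcal{F}=\{X-Y: X,Y\in\mathcal{R}\}$, where $(\mathcal F,+)$ is the group of differences, $(A-B)\oplus(A'-B')=\bigl((A+B')\oplus(A'+B)\bigr)-(B+B')$, and the order is defined by the same rule. Standing assumptions: (i) there is a fixed $E\in\mathcal{R}$ such that for every $X\in\mathcal{R}$ there is $t\in\mathbb{Q}^+$ with $-tE\le X\le tE$ (inequalities in $\mathcal{F}$); (ii) for $X,Y\in\mathcal{R}$ set $r(X-Y)=\inf\{t\in\mathbb{Q}^+: -tE\le X-Y\le tE\}$; then $r(X-Y)=0$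 implies $X=Y$. $S_E(\mathcal{R})$ is the set of maps $\phi:\mathcal{R}\to\mathbb{R}$ with $\phi(X\oplus Y)=\max(\phi(X),\phi(Y))$, $\phi(X+Y)=\phi(X)+\phi(Y)$ and $\phi(E)=1$, endowed with the weakest topology making all maps $\phi\mapsto\phi(X)$, $X\in\mathcal{R}$, continuous. *)

(* Defs.v *)
From HB Require Import structures.
From mathcomp Require Import all_boot all_order all_algebra generic_quotient.
From mathcomp Require Import all_classical all_reals all_analysis.

Set Implicit Arguments.
Unset Strict Implicit.
Unset Printing Implicit Defensive.

Import Order.TTheory GRing.Theory Num.Theory.
Import numFieldNormedType.Exports.

Local Open Scope quotient_scope.
Local Open Scope classical_set_scope.
Local Open Scope ring_scope.

(* In characteristic 1 the "multiplication" of the semi-ring is written [+],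
   with neutral element [0], so that the underlying [nmodType] carries the
   multiplicative law and [oplus] is the idempotent "addition"; the latter is
   not required to have a neutral element. *)
HB.mixin Record isSemiRing1 R & GRing.Nmodule R := {
  oplus : R -> R -> R;
  oplusA : associative oplus;
  oplusC : commutative oplus;
  oplusxx : idempotent_op oplus;
  addr_oplusr : right_distributive (@GRing.add R) oplus
}.

#[short(type="semiRing1Type")]
HB.structure Definition SemiRing1 := {R of isSemiRing1 R & GRing.Nmodule R}.

Notation "X ⊕ Y" := (oplus X Y) (at level 50, left associativity) : ring_scope.

HB.mixin Record isCancellative R & GRing.Nmodule R := {
  cancellative : forall X Y Z : R, X + Y = X + Z -> Y = Z
}.

#[short(type="cancSemiRing1Type")]
HB.structure Definition CancSemiRing1 :=
  {R of SemiRing1 R & isCancellative R}.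

HB.mixin Record isPerfect R & GRing.Nmodule R := {
  perfect : forall n : nat, (0 < n)%N -> forall X : R, exists Y : R, Y *+ n = X
}.

#[short(type="perfectCancSemiRing1Type")]
HB.structure Definition PerfectCancSemiRing1 :=
  {R of CancSemiRing1 R & isPerfect R}.

Definition ole (R : semiRing1Type) (X Y : R) : Prop := X ⊕ Y = Y.

Notation "X ⊑ Y" := (ole X Y) (at level 70, no associativity) : ring_scope.

Definition semiring1_hom (R S : semiRing1Type) (f : R -> S) : Prop :=
  [/\ f 0 = 0,
      {morph f : X Y / X + Y >-> X + Y} &
      {morph f : X Y / X ⊕ Y >-> X ⊕ Y}].

Section RationalAction.
Variable R : perfectCancSemiRing1Type.
Implicit Types (X Y Z : R) (f g : nat -> R) (t : rat) (n : nat).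

Fixpoint iter_oplus (f : nat -> R) n : R :=
  if n is m.+1 then iter_oplus f m ⊕ f n else f 0%N.

Lemma iter_oplusSl f n :
  iter_oplus f n.+1 = f 0%N ⊕ iter_oplus (fun i => f i.+1) n.
Proof.
elim: n => [//|n IH].
by rewrite [LHS](erefl : _ = iter_oplus f n.+1 ⊕ f n.+2) IH -oplusA.
Qed.

Lemma add_iter_oplus Z f n :
  Z + iter_oplus f n = iter_oplus (fun i => Z + f i) n.
Proof. by elim: n => [//|n IH] /=; rewrite addr_oplusr IH. Qed.

Lemma eq_iter_oplus f g n :
  (forall i, (i <= n)%N -> f i = g i) -> iter_oplus f n = iter_oplus g n.
Proof.
elim: n => [|n IH] fg /=; first exact: fg.
by rewrite fg // IH // => i ni; apply: fg; apply: leqW.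
Qed.

Lemma mulrnI n X Y : (0 < n)%N -> X *+ n = Y *+ n -> X = Y.
Proof.
case: n => [//|[|n]] _ XY //.
pose g i := X *+ (n.+2 - i) + Y *+ i.
pose s := iter_oplus (fun i => X *+ (n.+1 - i) + Y *+ i) n.+1.
have Xs : s + X = iter_oplus g n.+1.
  rewrite addrC add_iter_oplus; apply: eq_iter_oplus => i ni.
  by rewrite /g addrA -mulrS (@subSn _ n.+1).
have Ys : s + Y = iter_oplus (fun i => g i.+1) n.+1.
  rewrite addrC add_iter_oplus; apply: eq_iter_oplus => i ni.
  by rewrite /g addrCA -mulrS subSS.
apply: (@cancellative _ s); rewrite Xs Ys iter_oplusSl oplusC.
by apply: (congr1 (oplus _)); rewrite /g subn0 subnn mulr0n addr0 add0r.
Qed.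

Lemma qact_subproof t X : exists Y : R, Y *+ `|denq t|%N == X *+ `|numq t|%N.
Proof.
have [|Y <-] := @perfect R `|denq t|%N _ (X *+ `|numq t|%N).
  by rewrite absz_gt0 denq_neq0.
by exists Y.
Qed.

(* [qact (a / b) X] is the Y with b Y = a X; it is only meant for t >= 0, the
   absolute values merely turn integers into natural numbers. *)
Definition qact t X : R := xchoose (qact_subproof t X).

Lemma qactP t X : qact t X *+ `|denq t|%N = X *+ `|numq t|%N.
Proof. exact/eqP/(xchooseP (qact_subproof t X)). Qed.

Lemma qact_uniq t X Y : Y *+ `|denq t|%N = X *+ `|numq t|%N -> Y = qact t X.
Proof.
by rewrite -qactP; apply: mulrnI; rewrite absz_gt0 denq_neq0.
Qed.

End RationalAction.

(* The semi-field of fractions of R: pairs (A, B), standing for A - B, modulo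
   (A, B) ~ (A', B') iff A + B' = A' + B. *)
Module Fractions.
Section Fractions.
Variable R : cancSemiRing1Type.
Implicit Types u v w : R * R.

Lemma addIc (Z X Y : R) : X + Z = Y + Z -> X = Y.
Proof. by rewrite ![_ + Z]addrC; apply: cancellative. Qed.

Definition equivd u v : bool := u.1 + v.2 == v.1 + u.2.

Lemma equivd_refl : reflexive equivd.
Proof. by move=> u; rewrite /equivd. Qed.

Lemma equivd_sym : symmetric equivd.
Proof. by move=> u v; rewrite /equivd eq_sym. Qed.

Lemma equivd_trans : transitive equivd.
Proof.
move=> v u w /eqP uv /eqP vw; apply/eqP; apply: (@addIc v.2).
by rewrite addrAC uv addrAC vw addrAC.
Qed.

Canonical equivd_equiv := EquivRel equivd equivd_refl equivd_sym equivd_trans.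

Definition type := {eq_quot equivd}.

HB.instance Definition _ : EqQuotient _ equivd type := EqQuotient.on type.
HB.instance Definition _ := Choice.on type.

Lemma equivd_repr u : u.1 + (repr (\pi_type u)).2 = (repr (\pi_type u)).1 + u.2.
Proof.
by have /eqmodP/eqP : u = repr (\pi_type u) %[mod type] by rewrite reprK.
Qed.

Definition zerod : R * R := (0, 0).
Definition addd u v : R * R := (u.1 + v.1, u.2 + v.2).
Definition oppd u : R * R := (u.2, u.1).
Definition oplusd u v : R * R := ((u.1 + v.2) ⊕ (v.1 + u.2), u.2 + v.2).

Definition zero := lift_cst type zerod.
Canonical pi_zero_morph := PiConst zero.

Definition add := lift_op2 type addd.
Lemma pi_add : {morph \pi : u v / addd u v >-> add u v}.
Proof.
move=> u v; unlock add; apply/eqmodP/eqP => /=.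
by rewrite addrACA !equivd_repr addrACA.
Qed.
Canonical pi_add_morph := PiMorph2 pi_add.

Definition opp := lift_op1 type oppd.
Lemma pi_opp : {morph \pi : u / oppd u >-> opp u}.
Proof.
move=> u; unlock opp; apply/eqmodP/eqP => /=.
by rewrite addrC -equivd_repr addrC.
Qed.
Canonical pi_opp_morph := PiMorph1 pi_opp.

Definition oplusf := lift_op2 type oplusd.
Lemma pi_oplus : {morph \pi : u v / oplusd u v >-> oplusf u v}.
Proof.
move=> u v; unlock oplusf; apply/eqmodP/eqP => /=.
rewrite ![_ ⊕ _ + _]addrC !addr_oplusr.
have := equivd_repr u; have := equivd_repr v.
move: (repr (\pi_type u)) (repr (\pi_type v)) => [a b] [c d] /= ev eu.
congr (_ ⊕ _).
  by rewrite (AC (2*2) ((3*1)*(2*4))) /= eu [RHS](AC (2*2) ((3*1)*(4*2))).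
by rewrite (AC (2*2) ((3*2)*(1*4))) /= ev [RHS](AC (2*2) ((3*2)*(4*1))).
Qed.
Canonical pi_oplus_morph := PiMorph2 pi_oplus.

Lemma addA : associative add.
Proof.
by elim/quotW=> u; elim/quotW=> v; elim/quotW=> w; rewrite !piE /addd /= !addrA.
Qed.

Lemma addC : commutative add.
Proof.
by elim/quotW=> u; elim/quotW=> v; rewrite !piE /addd addrC [u.2 + _]addrC.
Qed.

Lemma add0 : left_id zero add.
Proof. by elim/quotW=> u; rewrite !piE /addd /= !add0r; case: u. Qed.

Lemma addN : left_inverse zero opp add.
Proof.
by elim/quotW=> u; rewrite !piE; apply/eqmodP/eqP; rewrite /= addr0 add0r addrC.
Qed.

HB.instance Definition _ := GRing.isZmodule.Build type addA addC add0 addN.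

Lemma oplusfA : associative oplusf.
Proof.
elim/quotW=> u; elim/quotW=> v; elim/quotW=> w; rewrite !piE.
apply: (congr1 \pi_type); rewrite /oplusd /=; congr pair; last by rewrite addrA.
rewrite ![(_ ⊕ _) + _]addrC !addr_oplusr oplusA; congr (_ ⊕ _ ⊕ _).
- by rewrite (AC (1*2) (3*(1*2))).
- by rewrite (AC (1*2) (3*(2*1))).
- by rewrite (AC (1*2) (2*(1*3))).
Qed.

Lemma oplusfC : commutative oplusf.
Proof.
by elim/quotW=> u; elim/quotW=> v; rewrite !piE /oplusd oplusC [u.2 + _]addrC.
Qed.

Lemma oplusfxx : idempotent_op oplusf.
Proof.
elim/quotW=> u; rewrite /= !piE; apply/eqmodP/eqP.
by rewrite /= oplusxx addrA.
Qed.

Lemma addf_oplusr : right_distributive add oplusf.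
Proof.
elim/quotW=> u; elim/quotW=> v; elim/quotW=> w; rewrite !piE.
apply/eqmodP/eqP; rewrite /= addr_oplusr ![(_ ⊕ _) + _]addrC !addr_oplusr.
by congr (_ ⊕ _);
  rewrite (AC (2*2*(1*2)) ((1*(2*4))*((5*6)*(3*7)))).
Qed.

HB.instance Definition _ :=
  isSemiRing1.Build type oplusfA oplusfC oplusfxx addf_oplusr.

Definition embed (X : R) : type := \pi_type (X, 0).

Lemma embedD : {morph embed : X Y / X + Y}.
Proof. by move=> X Y; rewrite /embed -[RHS]pi_add /addd /= addr0. Qed.

Lemma embed_oplus : {morph embed : X Y / X ⊕ Y}.
Proof. by move=> X Y; rewrite /embed -[RHS]pi_oplus /oplusd /= !addr0. Qed.

Lemma embed_inj : injective embed.
Proof. by move=> X Y /eqmodP/eqP /=; rewrite !addr0. Qed.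

Lemma pi_diff (A B : R) : \pi_type (A, B) = embed A - embed B.
Proof.
by rewrite /embed -[- _]pi_opp -[RHS]pi_add /addd /oppd /= addr0 add0r.
Qed.

Lemma diff_surj (x : type) : exists A B : R, x = embed A - embed B.
Proof. by elim/quotW: x => -[A B]; exists A, B; rewrite pi_diff. Qed.

Lemma oplus_diff (A B A' B' : R) :
  (embed A - embed B) ⊕ (embed A' - embed B') =
  embed ((A + B') ⊕ (A' + B)) - embed (B + B').
Proof. by rewrite -!pi_diff -[LHS]pi_oplus. Qed.

End Fractions.
End Fractions.
HB.export Fractions.

Notation semifield := Fractions.type.
Notation "X %:F" := (Fractions.embed X) : ring_scope.

Definition in_band (R : perfectCancSemiRing1Type) (E : R) (t : rat)
    (x : semifield R) : Prop :=
  - (qact t E)%:F ⊑ x /\ x ⊑ (qact t E)%:F.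

(* The infimum is a junk value on an empty set; the set is nonempty for every
   x as soon as every X in R lies in some band -tE <= X <= tE. *)
Definition Eradius (K : realType) (R : perfectCancSemiRing1Type) (E : R)
    (x : semifield R) : K :=
  inf [set ratr t | t in [set t : rat | 0 < t /\ in_band E t x]].

Record spectrum (K : realType) (R : semiRing1Type) (E : R) := Spectrum {
  spectrum_fun :> R -> K;
  spectrum_max : forall X Y : R,
    spectrum_fun (X ⊕ Y) = Num.max (spectrum_fun X) (spectrum_fun Y);
  spectrum_add : forall X Y : R,
    spectrum_fun (X + Y) = spectrum_fun X + spectrum_fun Y;
  spectrum_unit : spectrum_fun E = 1
}.

Section SpectrumTopology.
Variables (K : realType) (R : semiRing1Type) (E : R).

HB.instance Definition _ := gen_eqMixin (spectrum K E).
HB.instance Definition _ := gen_choiceMixin (spectrum K E).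

Definition spectrum_eval (X : R) (phi : spectrum K E) : K := phi X.

(* The weakest topology making all evaluations continuous. *)
HB.instance Definition _ := Topological.copy (spectrum K E)
  (sup_topology
     (fun X : R => Topological.on (initial_topology (spectrum_eval X)))).

End SpectrumTopology.

(* C^0(S, K) as a semi-ring of characteristic 1, for the pointwise (max, +). *)
Section ContinuousFunctions.
Variables (S : topologicalType) (K : realType).
Implicit Types f g h : continuousType S K.

Lemma cts_zero : continuous (fun _ : S => 0 : K).
Proof. by move=> x; exact: cvg_cst. Qed.

Lemma cts_add f g : continuous (fun x => f x + g x).
Proof. by move=> x; apply: cvgD; exact: cts_fun. Qed.

Lemma cts_opp f : continuous (fun x => - f x).
Proof. by move=> x; apply: cvgN; exact: cts_fun. Qed.

Lemma cts_max f g : continuous (fun x => Num.max (f x) (g x)).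
Proof.
have -> : (fun x => Num.max (f x) (g x)) =
          (fun x => (f x + g x + `|f x - g x|) / 2).
  by apply/funext => x; rewrite maxr_absE.
move=> x; apply: cvgMr_tmp; apply: cvgD; first exact: cts_add.
by apply: cvg_norm; apply: cvgB; exact: cts_fun.
Qed.

Definition c0_zero : continuousType S K := mkcts cts_zero.
Definition c0_add f g : continuousType S K := mkcts (cts_add (f:=f) (g:=g)).
Definition c0_opp f : continuousType S K := mkcts (cts_opp (f:=f)).
Definition c0_max f g : continuousType S K := mkcts (cts_max (f:=f) (g:=g)).

Lemma c0_addA : associative c0_add.
Proof. by move=> f g h; apply/continuousEP => x; exact: addrA. Qed.

Lemma c0_addC : commutative c0_add.
Proof. by move=> f g; apply/continuousEP => x; exact: addrC. Qed.

Lemma c0_add0 : left_id c0_zero c0_add.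
Proof. by move=> f; apply/continuousEP => x; exact: add0r. Qed.

Lemma c0_addN : left_inverse c0_zero c0_opp c0_add.
Proof. by move=> f; apply/continuousEP => x; exact: addNr. Qed.

HB.instance Definition _ := GRing.isZmodule.Build (continuousType S K)
  c0_addA c0_addC c0_add0 c0_addN.

Lemma c0_maxA : associative c0_max.
Proof. by move=> f g h; apply/continuousEP => x; exact: maxA. Qed.

Lemma c0_maxC : commutative c0_max.
Proof. by move=> f g; apply/continuousEP => x; exact: maxC. Qed.

Lemma c0_maxxx : idempotent_op c0_max.
Proof. by move=> f; apply/continuousEP => x; exact: maxxx. Qed.

Lemma c0_add_maxr : right_distributive (@GRing.add (continuousType S K)) c0_max.
Proof. by move=> f g h; apply/continuousEP => x; exact: addr_maxr. Qed.

HB.instance Definition _ := isSemiRing1.Build (continuousType S K)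
  c0_maxA c0_maxC c0_maxxx c0_add_maxr.

End ContinuousFunctions.

(* Main.v *)
(* Call a functional p : F -> K on the semi-field of fractions max-sublinear if
   p (x ⊕ y) = max (p x, p y), p is subadditive and p (n x) = n p x. For such p
   and z in F, the infimum over n of p (x + n z) - n p z is again max-sublinear,
   lies below p and is at most - p z at - z; hence a pointwise minimal
   max-sublinear functional is additive, and Zorn's lemma provides one below any
   given p. Starting from the gauge p x = inf {t : x <= t E}, first reduced along
   a = X - Y, this produces phi in S_E(R) with phi X - phi Y >= p a. If all phi
   agree on X and Y, then p is nonpositive at X - Y and at Y - X, i.e.
   r (X - Y) = 0, and X = Y. *)
Require Import Defs.
From mathcomp Require Import all_boot all_order all_algebra.
From mathcomp Require Import all_classical all_reals all_analysis.

Import Order.TTheory GRing.Theory Num.Theory.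
Import numFieldNormedType.Exports.

Set Implicit Arguments.
Unset Strict Implicit.
Unset Printing Implicit Defensive.

Local Open Scope ring_scope.

(** * The partial order of an idempotent law *)

Section IdempotentOrder.
Variable G : semiRing1Type.
Implicit Types x y z : G.

Lemma ole_refl x : x ⊑ x. Proof. exact: oplusxx. Qed.

Lemma ole_trans y x z : x ⊑ y -> y ⊑ z -> x ⊑ z.
Proof. by rewrite /ole => xy yz; rewrite -yz oplusA xy. Qed.

Lemma ole_anti x y : x ⊑ y -> y ⊑ x -> x = y.
Proof. by rewrite /ole => xy yx; rewrite -yx oplusC xy. Qed.

Lemma ole_oplusl x y : x ⊑ x ⊕ y.
Proof. by rewrite /ole oplusA oplusxx. Qed.

Lemma ole_oplusr x y : y ⊑ x ⊕ y.
Proof. by rewrite oplusC; exact: ole_oplusl. Qed.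

Lemma oplus_ole x y z : x ⊑ z -> y ⊑ z -> x ⊕ y ⊑ z.
Proof. by rewrite /ole => xz yz; rewrite -oplusA yz xz. Qed.

Lemma ole_add2l z x y : x ⊑ y -> z + x ⊑ z + y.
Proof. by rewrite /ole -addr_oplusr => ->. Qed.

Lemma ole_add x y x' y' : x ⊑ y -> x' ⊑ y' -> x + x' ⊑ y + y'.
Proof.
move=> xy /(ole_add2l y); apply: ole_trans.
by rewrite ![_ + x']addrC; exact: ole_add2l.
Qed.

Lemma ole_mulrn n x y : x ⊑ y -> x *+ n ⊑ y *+ n.
Proof.
move=> xy; elim: n => [|n IH]; first by rewrite !mulr0n; exact: ole_refl.
by rewrite !mulrS; exact: ole_add.
Qed.

End IdempotentOrder.

(** * Order and divisibility in the semi-field of fractions *)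

Section SemifieldOrder.
Variable R : perfectCancSemiRing1Type.
Implicit Types x y z : semifield R.

Lemma ole_subr_ge0 x y : 0 ⊑ y - x -> x ⊑ y.
Proof. by move=> /(ole_add2l x); rewrite addr0 addrC subrK. Qed.

Lemma subr_ole_ge0 x y : x ⊑ y -> 0 ⊑ y - x.
Proof. by move=> /(ole_add2l (- x)); rewrite addNr addrC. Qed.

Lemma oleN2 x y : x ⊑ y -> - y ⊑ - x.
Proof.
by move=> /subr_ole_ge0 xy; apply: ole_subr_ge0; rewrite opprK addrC.
Qed.

(** Expanding one factor [x ⊕ 0] leaves, besides the two terms kept, only [(x ⊕ 0) *+ n + x] from
    the induction hypothesis, which is absorbed because multiples of [x ⊕ 0] increase. *)
Lemma mulrSn_oplus0 x n :
  (x ⊕ 0) *+ n.+1 = ((x ⊕ 0) *+ n + x) ⊕ 0.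
Proof.
elim: n => [|n IH]; first by rewrite mulr0n add0r mulr1n.
rewrite mulrSr addr_oplusr addr0 {2}IH oplusA; congr (_ ⊕ _).
rewrite oplusC -/(ole _ _) ![_ + x]addrC; apply: ole_add2l.
rewrite mulrSr -{1}[_ *+ n]addr0; apply: ole_add2l; exact: ole_oplusr.
Qed.

(** With [n.+1] for the exponent, 0 lies below [x *+ n.+1], hence below [(x ⊕ 0) *+ n + x], so
    [mulrSn_oplus0] loses its final [⊕ 0]; cancelling [(x ⊕ 0) *+ n] leaves [x ⊕ 0 = x]. *)
Lemma mulrn_ge0 x n : (0 < n)%N -> 0 ⊑ x *+ n -> 0 ⊑ x.
Proof.
case: n => // n _ nx; rewrite /ole oplusC.
apply: (@addrI _ ((x ⊕ 0) *+ n)); rewrite -mulrSr mulrSn_oplus0 oplusC.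
apply: (ole_trans nx); rewrite mulrSr ![_ + x]addrC.
by apply/ole_add2l/ole_mulrn; exact: ole_oplusl.
Qed.

Lemma mulrn_ole2 x y n : (0 < n)%N -> x *+ n ⊑ y *+ n -> x ⊑ y.
Proof.
move=> n0 /subr_ole_ge0; rewrite -mulrnBl => /(mulrn_ge0 n0).
exact: ole_subr_ge0.
Qed.

Lemma embed0 : (0 : R)%:F = 0.
Proof. by apply: (@addrI _ 0%:F); rewrite -Fractions.embedD !addr0. Qed.

Lemma embedMn (X : R) n : (X *+ n)%:F = X%:F *+ n.
Proof.
elim: n => [|n IH]; first by rewrite !mulr0n embed0.
by rewrite !mulrS Fractions.embedD IH.
Qed.

Lemma semifield_perfect n x : (0 < n)%N -> exists y, y *+ n = x.
Proof.
move=> n0; have [A [B ->]] := Fractions.diff_surj x.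
have [A' <-] := perfect _ n0 A; have [B' <-] := perfect _ n0 B.
exists (A'%:F - B'%:F); by rewrite mulrnBl -!embedMn.
Qed.

(** Perfectness lets [z] be divided by [n], which reduces the claim to the case of a common upper
    bound. *)
Lemma oplus_mulrn_ole x y z n :
  (0 < n)%N -> x *+ n ⊑ z -> y *+ n ⊑ z -> (x ⊕ y) *+ n ⊑ z.
Proof.
move=> n0; have [w <-] := semifield_perfect z n0.
move=> /(mulrn_ole2 n0) xw /(mulrn_ole2 n0) yw.
exact/ole_mulrn/oplus_ole.
Qed.

End SemifieldOrder.

(** * Max-sublinear functionals and their minimal elements *)

Section MaxSublinear.
Variables (K : realType) (R : perfectCancSemiRing1Type).
Local Notation G := (semifield R).
Implicit Types (p q f g h : G -> K) (x y z : G).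

Record max_sublinear p : Prop := MaxSublinear {
  ms_max : forall x y, p (x ⊕ y) = Num.max (p x) (p y);
  ms_add : forall x y, p (x + y) <= p x + p y;
  ms_mulrn : forall x n, p (x *+ n) = p x *+ n
}.

Lemma ms0 p : max_sublinear p -> p 0 = 0.
Proof. by move=> mp; rewrite -(mulr0n 0) (ms_mulrn mp) mulr0n. Qed.

Lemma ms_geN p x : max_sublinear p -> - p (- x) <= p x.
Proof.
by move=> mp; rewrite -subr_ge0 opprK -(ms0 mp) -(subrr x); exact: ms_add.
Qed.

(** * Pointwise infima of directed families *)

Section Infimum.
Variables (A : set (G -> K)) (b : G -> K).
Hypothesis A0 : (A !=set0)%classic.
Hypothesis Amax : forall f, A f -> forall x y, f (x ⊕ y) = Num.max (f x) (f y).
Hypothesis Aadd : forall f g, A f -> A g ->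
  exists h, [/\ A h, forall x, h x <= Num.min (f x) (g x) &
                     forall x y, h (x + y) <= f x + g y].
Hypothesis Aub : forall f n, A f ->
  exists2 h, A h & forall x, h (x *+ n) <= f x *+ n.
Hypothesis Alb : forall f n, A f ->
  exists2 h, A h & forall x, h x *+ n <= f (x *+ n).
Hypothesis Ab : forall f x, A f -> b x <= f x.

Definition pointwise_inf x : K := inf [set f x | f in A]%classic.

Lemma pointwise_inf_le f x : A f -> pointwise_inf x <= f x.
Proof.
move=> Af; apply: ge_inf; last by exists f.
by exists (b x) => _ [g Ag <-]; exact: Ab.
Qed.

Lemma pointwise_inf_ge c x : (forall f, A f -> c <= f x) -> c <= pointwise_inf x.
Proof.
move=> h; apply: lb_le_inf; first by have [f Af] := A0; exists (f x), f.
by move=> _ [g Ag <-]; exact: h.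
Qed.

Lemma pointwise_inf_lt c x : pointwise_inf x < c -> exists2 f, A f & f x < c.
Proof.
move=> /inf_lt -[|_ [f Af <-] fc]; last by exists f.
by have [f Af] := A0; exists (f x), f.
Qed.

(** Members of [A] preserve max, but subadditivity and homogeneity are asked only up to passing to
    another member. This covers both the sequence used in the reduction along [z] and the chains in
    Zorn's lemma. Directedness ([Aadd]) is what makes the infimum commute with max. *)
Lemma pointwise_inf_max_sublinear : max_sublinear pointwise_inf.
Proof.
split=> [x y|x y|x n].
- apply/eqP; rewrite eq_le ge_max; apply/and3P; split.
  + apply/unstable.ler_gtP => c; rewrite gt_max => /andP[].
    move=> /pointwise_inf_lt[f Af fc] /pointwise_inf_lt[g Ag gc].
    have [h [Ah hfg _]] := Aadd Af Ag.
    apply: le_trans (pointwise_inf_le _ Ah) _; rewrite Amax// ge_max.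
    have := hfg x; have := hfg y; rewrite !le_min => /andP[_ hy] /andP[hx _].
    by rewrite (le_trans hx (ltW fc)) (le_trans hy (ltW gc)).
  + apply: pointwise_inf_ge => f Af; apply: le_trans (pointwise_inf_le _ Af) _.
    by rewrite Amax// le_max lexx.
  + apply: pointwise_inf_ge => f Af; apply: le_trans (pointwise_inf_le _ Af) _.
    by rewrite Amax// le_max lexx orbT.
- rewrite -lerBlDr; apply: pointwise_inf_ge => f Af.
  rewrite lerBlDr -lerBlDl; apply: pointwise_inf_ge => g Ag.
  rewrite lerBlDl; have [h [Ah _ hfg]] := Aadd Af Ag.
  exact: le_trans (pointwise_inf_le _ Ah) (hfg _ _).
- apply/eqP; rewrite eq_le; apply/andP; split.
  (* Division by [n] is impossible for [n = 0]; there [Aub] supplies a member with value at most 0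
     at 0. *)
  + have [->|n0] := eqVneq n 0%N.
      have [f /(Aub 0)[h Ah h0]] := A0.
      by have := le_trans (pointwise_inf_le _ Ah) (h0 x); rewrite !mulr0n.
    rewrite -mulr_natr -ler_pdivrMr ?ltr0n ?lt0n//.
    apply: pointwise_inf_ge => f /(Aub n)[h Ah hf].
    rewrite ler_pdivrMr ?ltr0n ?lt0n// mulr_natr.
    exact: le_trans (pointwise_inf_le _ Ah) (hf x).
  + apply: pointwise_inf_ge => f /(Alb n)[h Ah hf]; apply: le_trans (hf x).
    by rewrite lerMn2r pointwise_inf_le ?orbT.
Qed.

End Infimum.

(* The directional derivative at infinity of [p] along [z]; homogeneity of [p]
   is what keeps it finite and makes it linear on the multiples of [z]. *)
Lemma max_sublinear_reduce p z : max_sublinear p ->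
  exists q, [/\ max_sublinear q, forall x, q x <= p x & q (- z) <= - p z].
Proof.
move=> mp; pose f n x := p (x + z *+ n) - p z *+ n.
(* Raising the index from [m] to [n] adds at most [p z *+ (n - m)] to the first term and subtracts
   exactly that. *)
have f_anti m n x : (m <= n)%N -> f n x <= f m x.
  move=> /subnK <-; rewrite /f mulrnDr addrCA addrA mulrnDr opprD addrA.
  rewrite lerD2r lerBlDr -addrA addrC (le_trans (ms_add mp _ _))//.
  by rewrite (ms_mulrn mp) addrC.
have f_max n x y : f n (x ⊕ y) = Num.max (f n x) (f n y).
  by rewrite /f ![_ + z *+ n]addrC addr_oplusr ms_max// addr_maxl.
have fM n k x : f (n * k)%N (x *+ k) = f n x *+ k.
  by rewrite /f mulrnBl -(ms_mulrn mp (x + _)) mulrnDl !mulrnA.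
(* Subadditivity for [z *+ n = - x + (x + z *+ n)] gives a lower bound free of [n]. *)
have fb n x : - p (- x) <= f n x.
  rewrite lerBrDr addrC -(ms_mulrn mp) lerBlDr [leRHS]addrC.
  by rewrite -{1}(addKr x (z *+ n)) ms_add.
exists (pointwise_inf [set f n | n in setT]%classic); split.
- apply: (@pointwise_inf_max_sublinear _ (fun x => - p (- x))).
  + by exists (f 0%N), 0%N.
  + by move=> _ [n _ <-] x y.
  + move=> _ _ [m _ <-] [n _ <-]; exists (f (m + n)%N); split.
    * by exists (m + n)%N.
    * by move=> x; rewrite le_min !f_anti ?leq_addr ?leq_addl.
    * move=> x y; rewrite /f !mulrnDr addrACA opprD [leRHS]addrACA.
      by rewrite lerD2r ms_add.
  + move=> _ k [n _ <-]; exists (f (n * k)%N); first by exists (n * k)%N.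
    by move=> x; rewrite fM.
  + move=> _ k [n _ <-]; exists (f n); first by exists n.
    move=> x; have [->|k0] := posnP k.
      by rewrite !mulr0n /f add0r (ms_mulrn mp) subrr.
    by rewrite -fM; apply: f_anti; rewrite leq_pmulr.
  + by move=> _ x [n _ <-].
- move=> x;
  apply: le_trans (@pointwise_inf_le _ (fun x => - p (- x)) _ (f 0%N) _ _) _.
  + by move=> _ y [n _ <-].
  + by exists 0%N.
  + by rewrite /f !mulr0n addr0 subr0.
(* Index 1 suffices: [f 1 (- z) = p 0 - p z]. *)
- apply: le_trans (@pointwise_inf_le _ (fun x => - p (- x)) _ (f 1%N) _ _) _.
  + by move=> _ y [n _ <-].
  + by exists 1%N.
  + by rewrite /f !mulr1n addNr ms0// sub0r.
Qed.

(** Zorn's lemma for the reversed pointwise order: a nonempty chain is bounded by its pointwise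
    infimum, finite because every max-sublinear functional below [q] is at least [- q (- x)] at
    [x]. *)
Lemma exists_minimal q : max_sublinear q -> exists p, [/\ max_sublinear p,
  forall x, p x <= q x &
  forall p', max_sublinear p' -> (forall x, p' x <= p x) -> p' =1 p].
Proof.
move=> mq; pose T := {p | max_sublinear p /\ forall x, p x <= q x}.
pose D (s t : T) := `[< forall x, sval t x <= sval s x >].
have qq : max_sublinear q /\ forall x, q x <= q x by [].
have [t|r s t|A tA|] := @ZL_preorder T (exist _ q qq) D.
- exact/asboolP.
- move=> /asboolP rs /asboolP st; apply/asboolP => x.
  exact: le_trans (st x) (rs x).
- have [[t0 At0]|A0] := pselect (A !=set0)%classic; last first.
    by exists (exist _ q qq) => s As; case: A0; exists s.
  pose B := [set sval t | t in A]%classic.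
  have Bb f x : B f -> - q (- x) <= f x.
    move=> [[p [mp pq]] _ <-] /=; apply: le_trans (ms_geN _ mp).
    by rewrite lerN2.
  have mB : max_sublinear (pointwise_inf B).
    apply: (pointwise_inf_max_sublinear (b := fun x => - q (- x))) => //.
    + by exists (sval t0), t0.
    + by move=> _ [[p [mp pq]] _ <-] x y; exact: ms_max.
    + move=> _ _ [s As <-] [t At <-].
      wlog /asboolP st : s t As At / D s t.
        move=> wl; have [st|ts] := tA _ _ As At; first exact: wl.
        have [h [Bh h1 h2]] := wl t s At As ts.
        exists h; split => // x; first by rewrite minC.
        by move=> y; rewrite addrC [leRHS]addrC.
      exists (sval t); split; first by exists t.
        by move=> x; rewrite le_min st lexx.
      move=> x y; apply: le_trans (ms_add (proj1 (svalP t)) _ _) _.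
      by rewrite lerD2r.
    + move=> _ n [t At <-]; exists (sval t); first by exists t.
      by move=> x; rewrite (ms_mulrn (proj1 (svalP t))).
    + move=> _ n [t At <-]; exists (sval t); first by exists t.
      by move=> x; rewrite (ms_mulrn (proj1 (svalP t))).
  have Bq x : pointwise_inf B x <= q x.
    apply: le_trans (proj2 (svalP t0) x).
    by apply: (pointwise_inf_le (b := fun x => - q (- x))) => //; exists t0.
  exists (exist _ (pointwise_inf B) (conj mB Bq)) => s As.
  apply/asboolP => x /=.
  by apply: (pointwise_inf_le (b := fun x => - q (- x))) => //; exists s.
- move=> [p [mp pq]] pmin; exists p; split => // p' mp' p'p x.
  have p'q y : p' y <= q y := le_trans (p'p y) (pq y).
  have /asboolP/(_ x)/= pp' :
      D (exist _ p' (conj mp' p'q)) (exist _ p (conj mp pq)).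
    by apply: pmin; apply/asboolP.
  by apply/eqP; rewrite eq_le p'p pp'.
Qed.

(** Reducing along [z] cannot change a minimal [p], so [p (- z) <= - p z]; then
    [p x <= p (x + y) + p (- y)] is the missing superadditivity. *)
Lemma minimal_additive p : max_sublinear p ->
  (forall p', max_sublinear p' -> (forall x, p' x <= p x) -> p' =1 p) ->
  forall x y, p (x + y) = p x + p y.
Proof.
move=> mp pmin.
have pN z : p (- z) <= - p z.
  have [q [mq qp qz]] := max_sublinear_reduce z mp.
  by rewrite -(pmin q mq qp).
move=> x y; apply/eqP; rewrite eq_le ms_add//=.
rewrite -lerBrDr -{1}(addrK y x) (le_trans (ms_add mp _ _))//.
by rewrite lerD2l pN.
Qed.

(* Reducing [p] along [a] before minimising forces [phi (- a) <= - p a]. *)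
Lemma max_sublinear_extend p a : max_sublinear p -> exists phi : G -> K,
  [/\ forall x y, phi (x ⊕ y) = Num.max (phi x) (phi y),
      forall x y, phi (x + y) = phi x + phi y,
      forall x, phi x <= p x & p a <= phi a].
Proof.
move=> mp; have [q [mq qp qa]] := max_sublinear_reduce a mp.
have [phi [mphi phiq phimin]] := exists_minimal mq.
exists phi; split.
- exact: ms_max.
- exact: minimal_additive.
- by move=> x; exact: le_trans (phiq x) (qp x).
(* The chain is [p a <= - q (- a) <= - phi (- a) <= phi a]. *)
- rewrite lerNr in qa; apply: (le_trans qa).
  by rewrite (le_trans _ (ms_geN a mphi))// lerN2.
Qed.

End MaxSublinear.

(** * The gauge of the order unit *)

Section Gauge.
Variables (K : realType) (R : perfectCancSemiRing1Type) (e : semifield R).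
Hypotheses (e_ge0 : 0 ⊑ e) (e_neq0 : e <> 0).
Hypothesis e_unit : forall x : semifield R,
  exists n (m : int), (0 < n)%N /\ x *+ n ⊑ e *~ m.
Implicit Types x y : semifield R.

Lemma intmul_unit_ge0 (m : int) : 0 ⊑ e *~ m -> 0 <= m.
Proof.
case: m => // n; rewrite NegzE mulrNz => /(ole_add2l (e *~ n.+1)).
rewrite addr0 subrr -pmulrn -[X in _ ⊑ X](mul0rn _ n.+1)
  => /(mulrn_ole2 (ltn0Sn n)) e0.
by case: e_neq0; exact: ole_anti.
Qed.

Lemma ole_intmul_unit (m n : int) : m <= n -> e *~ m ⊑ e *~ n.
Proof.
rewrite -subr_ge0 => mn; apply: ole_subr_ge0.
rewrite -mulrzBr; case: (n - m) mn => // k _.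
by rewrite -pmulrn -(mul0rn _ k); exact: ole_mulrn.
Qed.

Lemma ole_unit_scale x n (m : int) (k : nat) :
  x *+ n ⊑ e *~ m -> x *+ (n * k) ⊑ e *~ (m * k).
Proof. by move=> /(ole_mulrn k); rewrite mulrnA pmulrn mulrzA. Qed.

(** The infimum of the rationals [t] with [x <= t e], written with cleared denominators since [qact]
    acts on [R] and not on fractions; [m] may be negative. *)
Definition gauge x : K := inf [set v | exists n (m : int),
  [/\ (0 < n)%N, x *+ n ⊑ e *~ m & v = m%:~R / n%:R]]%classic.

Lemma ler_fracz (m m' : int) (n n' : nat) : (0 < n)%N -> (0 < n')%N ->
  (m%:~R / n%:R <= m'%:~R / n'%:R :> K) = (m * n' <= m' * n).
Proof.
move=> n0 n0'; rewrite ler_pdivrMr ?ltr0n// mulrAC ler_pdivlMr ?ltr0n//.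
by rewrite !pmulrn -!intrM ler_int.
Qed.

Lemma gauge_le x n (m : int) :
  (0 < n)%N -> x *+ n ⊑ e *~ m -> gauge x <= m%:~R / n%:R.
Proof.
move=> n0 xm; apply: ge_inf; last by exists n, m.
(* An upper bound [l / k] for [- x] bounds the set below by [- l / k]: adding the two inequalities
   over a common denominator puts 0 below a multiple of [e]. *)
have [k [l [k0 xl]]] := e_unit (- x).
exists ((- l)%:~R / k%:R) => _ [n' [m' [n0' xm' ->]]]; rewrite ler_fracz//.
rewrite mulNr -subr_ge0 opprK; apply: intmul_unit_ge0.
have := ole_add (ole_unit_scale k xm') (ole_unit_scale n' xl).
by rewrite -mulrzDr mulNrn mulnC subrr.
Qed.

Lemma gauge_lt x v : gauge x < v ->
  exists n (m : int), [/\ (0 < n)%N, x *+ n ⊑ e *~ m & m%:~R / n%:R < v].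
Proof.
move=> /inf_lt -[|_ [n [m [n0 xm ->]]] mv]; last by exists n, m.
by have [n [m [n0 xm]]] := e_unit x; exists (m%:~R / n%:R), n, m.
Qed.

Lemma gauge_max_sublinear : max_sublinear gauge.
Proof.
have mono x y : x ⊑ y -> gauge x <= gauge y.
  move=> xy; apply/unstable.ler_gtP => v /gauge_lt[n [m [n0 ym mv]]].
  apply: le_trans (ltW mv); apply: gauge_le => //.
  exact: ole_trans (ole_mulrn n xy) ym.
split=> [x y|x y|x k].
- apply/eqP; rewrite eq_le ge_max (mono _ _ (ole_oplusl x y)).
  rewrite (mono _ _ (ole_oplusr x y)) !andbT.
  apply/unstable.ler_gtP => v; rewrite gt_max => /andP[].
  move=> /gauge_lt[n [m [n0 xm mv]]] /gauge_lt[n' [m' [n0' ym' mv']]].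
  (* By symmetry [m' / n'] is the larger fraction; over the denominator [n' * n] it bounds both [x]
     and [y], so [oplus_mulrn_ole] applies. *)
  wlog mm' : x y n m n' m' n0 xm mv n0' ym' mv' /
      m%:~R / n%:R <= m'%:~R / n'%:R :> K.
    move=> wl; have [|/ltW] := leP (m%:~R / n%:R : K) (m'%:~R / n'%:R).
      exact: (wl x y).
    by rewrite oplusC; exact: (wl y x).
  apply: le_trans (ltW mv').
  have -> : m'%:~R / n'%:R = (m' * n)%:~R / (n' * n)%:R :> K.
    by rewrite intrM natrM -!pmulrn -mulf_div divff ?mulr1// pnatr_eq0 -lt0n.
  apply: gauge_le; first by rewrite muln_gt0 n0'.
  apply: oplus_mulrn_ole; first by rewrite muln_gt0 n0'.
    rewrite mulnC; apply: ole_trans (ole_unit_scale n' xm) _.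
    by apply: ole_intmul_unit; rewrite -(ler_fracz _ _ n0 n0').
  exact: ole_unit_scale.
- rewrite -lerBlDr; apply/unstable.ler_gtP => v /gauge_lt[n [m [n0 xm mv]]].
  rewrite lerBlDr -lerBlDl; apply/unstable.ler_gtP => w.
  move=> /gauge_lt[n' [m' [n0' ym' mw]]]; rewrite lerBlDl.
  apply: le_trans (lerD (ltW mv) (ltW mw)).
  rewrite addf_div ?pnatr_eq0 -?lt0n// -natrM !pmulrn -!intrM -intrD.
  apply: gauge_le; first by rewrite muln_gt0 n0.
  rewrite mulrnDl mulrzDr; apply: ole_add; first exact: ole_unit_scale.
  by rewrite mulnC; exact: ole_unit_scale.
- have [->|k0] := posnP k.
    (* The gauge vanishes at 0: the fraction 0 / 1 is admissible, and [intmul_unit_ge0] excludes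
       negative ones. *)
    rewrite !mulr0n; apply/eqP; rewrite eq_le; apply/andP; split.
      rewrite -[leRHS](mul0r (1%:R^-1)); apply: (@gauge_le _ 1 0) => //.
      by rewrite mulr1n mulr0z; exact: ole_refl.
    apply/unstable.ler_gtP => v /gauge_lt[n [m [n0 xm /ltW]]].
    apply: le_trans; rewrite divr_ge0// ler0z; apply: intmul_unit_ge0.
    by rewrite mul0rn in xm.
  apply/eqP; rewrite eq_le; apply/andP; split.
    rewrite -mulr_natr -ler_pdivrMr ?ltr0n//; apply/unstable.ler_gtP => v.
    move=> /gauge_lt[n [m [n0 xm mv]]]; rewrite ler_pdivrMr ?ltr0n//.
    apply: (@le_trans _ _ (m%:~R / n%:R * k%:R)); last first.
      by rewrite ler_pM2r ?ltr0n// ltW.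
    rewrite mulrAC (pmulrn 1 k) -intrM; apply: gauge_le => //.
    by rewrite -mulrnA mulnC; exact: ole_unit_scale.
  apply/unstable.ler_gtP => v /gauge_lt[n [m [n0 xm /ltW]]]; apply: le_trans.
  rewrite -(mulr_natr (gauge x) k) -ler_pdivlMr ?ltr0n// -mulrA -invfM -natrM.
  by apply: gauge_le; rewrite ?muln_gt0 ?n0// mulnC mulrnA.
Qed.

Lemma gauge_unit : gauge e <= 1.
Proof.
have e1 : e *+ 1 ⊑ e *~ 1 by exact: ole_refl.
by apply: le_trans (gauge_le _ e1) _; rewrite // divr1.
Qed.

(** Together with [gauge_unit] this forces the value 1 at [e] for any additive functional below the
    gauge. *)
Lemma gaugeN_unit : gauge (- e) <= - 1.
Proof.
have e1 : - e *+ 1 ⊑ e *~ (- 1) by exact: ole_refl.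
by apply: le_trans (gauge_le _ e1) _; rewrite // divr1 mulrNz.
Qed.

End Gauge.

(** * Points of the spectrum and the radius *)

Section Separation.
Variables (K : realType) (R : perfectCancSemiRing1Type) (E : R).
Hypothesis bounded : forall X : R, exists t : rat, 0 < t /\ in_band E t X%:F.
Local Notation e := (E%:F).

Lemma embed_qact t : (qact t E)%:F *+ `|denq t| = e *+ `|numq t|.
Proof. by rewrite -!embedMn qactP. Qed.

Lemma denq_absz_gt0 t : (0 < `|denq t|)%N.
Proof. by rewrite absz_gt0 denq_neq0. Qed.

Lemma embed_unit_ge0 : 0 ⊑ e.
Proof.
have [t [t0 [_]]] := bounded 0; rewrite embed0 => /(ole_mulrn `|denq t|).
rewrite mul0rn embed_qact; apply: mulrn_ge0.
by rewrite absz_gt0 numq_eq0 gt_eqF.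
Qed.

(** If [e] vanished, every band would collapse to 0. *)
Lemma embed_unit_neq0 (X : R) : X <> 0 -> e <> 0.
Proof.
move=> X0 e0; have [t [_ []]] := bounded X.
have -> : (qact t E)%:F = 0.
  have := embed_qact t; rewrite e0 mul0rn => q.
  by apply: ole_anti; apply: (mulrn_ole2 (denq_absz_gt0 t));
    rewrite q mul0rn; exact: ole_refl.
rewrite oppr0 => x0 x1; apply: X0; apply: Fractions.embed_inj.
by rewrite embed0; exact: ole_anti.
Qed.

Lemma embed_unit_bound (x : semifield R) :
  exists n (m : int), (0 < n)%N /\ x *+ n ⊑ e *~ m.
Proof.
have [A [B ->]] := Fractions.diff_surj x.
have [t [_ [_ /(ole_mulrn `|denq t|)]]] := bounded A.
have [s [_ [/oleN2 + _]]] := bounded B.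
rewrite opprK => /(ole_mulrn `|denq s|); rewrite !embed_qact !pmulrn.
move=> /(@ole_unit_scale _ e _ _ _ `|denq t|) sB.
move=> /(@ole_unit_scale _ e _ _ _ `|denq s|) tA.
exists (`|denq t| * `|denq s|)%N,
  (`|numq t| * `|denq s| + `|numq s| * `|denq t|).
split; first by rewrite muln_gt0 !denq_absz_gt0.
rewrite mulrnDl mulrzDr; apply: ole_add => //.
by rewrite mulnC.
Qed.

Lemma gauge_le0_ole (a : semifield R) : e <> 0 -> gauge K e a <= 0 ->
  forall t, 0 < t -> a ⊑ (qact t E)%:F.
Proof.
move=> e0 ga t t0; have : gauge K e a < ratr t.
  by apply: le_lt_trans ga _; rewrite ltr0q.
move=> /(gauge_lt embed_unit_bound)[n [m [n0 am]]].
have numE : numq t = `|numq t|%N by rewrite gez0_abs// ltW// numq_gt0.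
have denE : denq t = `|denq t|%N by rewrite gez0_abs.
rewrite /ratr denE -pmulrn => /ltW.
rewrite ler_fracz ?denq_absz_gt0// => mt.
(* Multiplying by both denominators turns the comparison of [m / n] with [t] into one of integer
   multiples of [e]. *)
apply: (mulrn_ole2 (n := n * `|denq t|)).
  by rewrite muln_gt0 n0 denq_absz_gt0.
apply: ole_trans (ole_unit_scale _ am) _.
apply: ole_trans (ole_intmul_unit embed_unit_ge0 mt) _.
rewrite mulnC mulrnA embed_qact numE mulrzA -!pmulrn; exact: ole_refl.
Qed.

(** This is the radius of an element lying in every band. *)
Lemma inf_ratr_pos :
  inf [set ratr t | t in [set t : rat | 0 < t]]%classic = 0 :> K.
Proof.
apply/eqP; rewrite eq_le; apply/andP; split; last first.
  apply: lb_le_inf; first by exists (ratr 1), 1.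
  by move=> _ [t t0 <-]; rewrite ler0q ltW.
apply/unstable.ler_gtP => v /rat_in_itvoo[t]; rewrite in_itv/= => /andP[t0 tv].
apply: le_trans (ltW tv); apply: ge_inf; last first.
  by exists t => //=; rewrite -(ltr0q K).
by exists 0 => _ [s s0 <-]; rewrite ler0q ltW.
Qed.

(** The gauge dominates an additive, max-preserving [phi] whose value at [X - Y] is at least the
    gauge there. Restricted to [R], [phi] is a point of the spectrum, so this value is at most 0. *)
Lemma spectrum_gauge (X Y : R) :
  e <> 0 -> (forall phi : spectrum K E, phi X <= phi Y) ->
  gauge K e (X%:F - Y%:F) <= 0.
Proof.
move=> e0 XY.
have mg := gauge_max_sublinear K embed_unit_ge0 e0 embed_unit_bound.
have [phi [phiM phiD phi_le phi_ge]] := max_sublinear_extend (X%:F - Y%:F) mg.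
have phi0 : phi 0 = 0 by apply: (addrI (phi 0)); rewrite -phiD !addr0.
have phiN x : phi (- x) = - phi x.
  by apply: (addrI (phi x)); rewrite -phiD !subrr.
have psiM (A B : R) : phi (A ⊕ B)%:F = Num.max (phi A%:F) (phi B%:F).
  by rewrite Fractions.embed_oplus phiM.
have psiD (A B : R) : phi (A + B)%:F = phi A%:F + phi B%:F.
  by rewrite Fractions.embedD phiD.
have psi1 : phi e = 1.
  apply/eqP; rewrite eq_le; apply/andP; split.
    exact: le_trans (phi_le _)
      (gauge_unit _ embed_unit_ge0 e0 embed_unit_bound).
  rewrite -lerN2 -phiN.
  exact: le_trans (phi_le _)
    (gaugeN_unit _ embed_unit_ge0 e0 embed_unit_bound).
have /= := XY (Spectrum psiM psiD psi1); rewrite -subr_le0.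
by apply: le_trans; rewrite -phiN -phiD.
Qed.

Lemma spectrum_separates (X Y : R) :
  (forall phi : spectrum K E, phi X = phi Y) -> e <> 0 ->
  Eradius K E (X%:F - Y%:F) = 0.
Proof.
move=> XY e0; rewrite /Eradius -inf_ratr_pos; congr (inf (image _ _)).
apply/seteqP; split=> [t []//|t t0]; split => //; split.
(* The lower half of the band is the upper bound for [Y - X]. *)
- rewrite -[_ - _]opprB; apply: oleN2; apply: gauge_le0_ole => //.
  by apply: spectrum_gauge => // phi; rewrite XY.
- by apply: gauge_le0_ole => //; apply: spectrum_gauge => // phi; rewrite XY.
Qed.

End Separation.

(** * Evaluation maps and the embedding *)

Lemma continuous_spectrum_eval (K : realType) (R : semiRing1Type) (E X : R) :
  continuous (fun phi : spectrum K E => phi X).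
Proof.
move=> phi; have /cvg_sup/(_ X) h : (nbhs phi --> phi)%classic by [].
exact: cvg_comp h (@initial_continuous _ _ (@spectrum_eval K R E X) phi).
Qed.

Theorem theorem9 (K : realType) (R : perfectCancSemiRing1Type) (E : R)
    (bounded : forall X : R, exists t : rat, 0 < t /\ in_band E t X%:F)
    (separated : forall X Y : R, Eradius K E (X%:F - Y%:F) = 0 -> X = Y) :
  exists j : R -> continuousType (spectrum K E) K,
    [/\ forall (X : R) (phi : spectrum K E), j X phi = phi X,
        semiring1_hom j & injective j].
Proof.
exists (fun X => mkcts (@continuous_spectrum_eval K R E X)); split => //.
- split=> [|X Y|X Y]; apply/continuousEP => phi /=.
  + by apply: (addrI (phi 0)); rewrite -spectrum_add !addr0.
  + exact: spectrum_add.
  + exact: spectrum_max.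
(* If [E = 0] the spectrum is empty and [XY] says nothing, but then [embed_unit_neq0] forces
   [X = Y = 0]; this case is split off first. *)
- move=> X Y /continuousEP XY; have [[-> ->]//|XY0] := pselect (X = 0 /\ Y = 0).
  apply/separated/spectrum_separates => // e0; apply: XY0.
  by split; apply: contrapT => /(embed_unit_neq0 bounded).
Qed.
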